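(* Let $R_1>0$ and consider the metric $$ds^2=-dt^2+B(r)^2[dr-\beta(r)\,dt]^2+r^2d\Omega^2,\qquad B(r)>0 .$$ Assume that it is regular for $r\ge R_1$ with $B\in C^1$, that it obeys the radial null energy condition in both directions, that it has a flat inner boundary $B(R_1)=1$, and that it is asymptotically flat with $\lim_{r\to\infty}B(r)=1$. Then $B(r)\equiv1$ for all $r\ge R_1$.
   Context: Geometric units $G=c=1$; the source is $T_{\mu\nu}=G_{\mu\nu}/(8\pi)$. Let $n^\mu=(1,\beta,0,0)$ be the future unit normal to the slices $t=\text{const}$, $e_{\hat r}^\mu=(0,B^{-1},0,0)$ the outward radial unit vector (coordinates $(t,r,\theta,\phi)$), and $k_\pm^\mu=n^\mu\pm e_{\hat r}^\mu$ the two future radial null vectors. The radial null energy condition in both directions is $T_{\mu\nu}k_+^\mu k_+^\nu\ge0$ and $T_{\mu\nu}k_-^\mu k_-^\nu\ge0$ for all $r\ge R_1$. For this metric the contractions are $$8\pi T_{\mu\nu}k_\pm^\mu k_\pm^\nu=\frac{2B'}{rB^3}(1\pm B\beta)^2,$$ which is how they are understood when $B$ is only $C^1$. *)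

(* Defs.v *)
From HB Require Import structures.
From mathcomp Require Import all_boot all_order all_algebra.
From mathcomp Require Import all_classical all_reals all_analysis.
From mathcomp Require Import ring.
Import Order.TTheory GRing.Theory Num.Theory numFieldNormedType.Exports.

Set Implicit Arguments.
Unset Strict Implicit.
Unset Printing Implicit Defensive.

Local Open Scope classical_set_scope.
Local Open Scope ring_scope.

(** Derivative of [f] at [x] relative to [D]; it is one-sided when [x] is an
    end point of an interval [D]. *)
Definition diffquot (R : realType) (f : R -> R) (x y : R) : R :=
  (f y - f x) / (y - x).

Definition derive_within (R : realType) (D : set R) (f : R -> R) (x : R) : R :=
  lim (diffquot f x y @[y --> within D x^']).

Definition C1_on (R : realType) (D : set R) (f : R -> R) : Prop :=
  (forall x, D x -> cvg (diffquot f x y @[y --> within D x^'])) /\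
  {within D, continuous (derive_within D f)}.

(** Tensor fields are given by their components in the coordinates
    (t, r, theta, phi), numbered 0, 1, 2, 3; a point is the row of its
    coordinates. *)
Definition radius (R : realType) (x : 'rV[R]_4) : R := x ord0 (inord 1).
Definition colatitude (R : realType) (x : 'rV[R]_4) : R := x ord0 (inord 2).

Definition exterior (R : realType) (R1 : R) : set 'rV[R]_4 :=
  [set x | R1 <= radius x /\ 0 < colatitude x < pi].

Definition vec4 (R : realType) (a b c d : R) : 'rV[R]_4 :=
  \row_j [:: a; b; c; d]`_j.

(** [g_(mu nu) u^mu v^nu]. *)
Definition contract (R : realType) (g : 'M[R]_4) (u v : 'rV[R]_4) : R :=
  \sum_mu \sum_nu g mu nu * u ord0 mu * v ord0 nu.

(** [- dt^2 + B^2 (dr - beta dt)^2 + r^2 (dtheta^2 + sin^2 theta dphi^2)]. *)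
Definition metric (R : realType) (B beta : R -> R) (x : 'rV[R]_4) : 'M[R]_4 :=
  let r := radius x in
  let sq (w : 'rV[R]_4) := w^T *m w in
  - sq (vec4 1 0 0 0)
  + B r ^+ 2 *: sq (vec4 (- beta r) 1 0 0)
  + r ^+ 2 *: (sq (vec4 0 0 1 0)
               + sin (colatitude x) ^+ 2 *: sq (vec4 0 0 0 1)).

Definition unit_normal (R : realType) (beta : R -> R) (x : 'rV[R]_4) :
  'rV[R]_4 := vec4 1 (beta (radius x)) 0 0.

Definition unit_radial (R : realType) (B : R -> R) (x : 'rV[R]_4) :
  'rV[R]_4 := vec4 0 (B (radius x))^-1 0 0.

(** [s = false] is the outgoing vector k_+, [s = true] the ingoing k_-. *)
Definition null_vec (R : realType) (B beta : R -> R) (s : bool)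
    (x : 'rV[R]_4) : 'rV[R]_4 :=
  unit_normal beta x + (-1) ^+ s *: unit_radial B x.

Lemma contract_metric (R : realType) (B beta : R -> R) (x : 'rV[R]_4)
    (a b c d : R) :
  contract (metric B beta x) (vec4 a b 0 0) (vec4 c d 0 0) =
  - (a * c) + B (radius x) ^+ 2 * (b - beta (radius x) * a)
                                * (d - beta (radius x) * c).
Proof.
rewrite /contract /metric !big_ord_recl !big_ord0 /=.
rewrite !mxE !big_ord1 !mxE /=.
ring.
Qed.

Lemma unit_normal_unit (R : realType) (B beta : R -> R) (x : 'rV[R]_4) :
  contract (metric B beta x) (unit_normal beta x) (unit_normal beta x) = -1.
Proof. by rewrite contract_metric; ring. Qed.

Lemma unit_radial_unit (R : realType) (B beta : R -> R) (x : 'rV[R]_4) :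
  0 < B (radius x) ->
  contract (metric B beta x) (unit_radial B x) (unit_radial B x) = 1.
Proof. by move=> B0; rewrite contract_metric; field; rewrite gt_eqF. Qed.

Lemma null_vec_null (R : realType) (B beta : R -> R) (s : bool)
    (x : 'rV[R]_4) :
  0 < B (radius x) ->
  contract (metric B beta x) (null_vec B beta s x) (null_vec B beta s x) = 0.
Proof.
move=> B0; have -> : null_vec B beta s x =
    vec4 1 (beta (radius x) + (-1) ^+ s / B (radius x)) 0 0.
  apply/rowP => j; rewrite !mxE.
  by case: j => -[|[|[|[|]]]] //= _; rewrite ?mulr0 ?addr0.
rewrite contract_metric; case: s; rewrite ?expr0 ?expr1; field;
  by rewrite gt_eqF.
Qed.

(** For [metric B beta] with [B] of class C^1 only, the second derivatives in
    the Einstein tensor need not exist, and [T = G / (8 pi)] is understood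
    through its contractions with the two radial null vectors:
    [8 pi T_(mu nu) k_s^mu k_s^nu = 2 B' / (r B^3) (1 +/- B beta)^2]. *)
Definition radial_stress_energy (R : realType) (R1 : R) (B beta : R -> R)
    (T : 'rV[R]_4 -> 'M[R]_4) : Prop :=
  forall (s : bool) (x : 'rV[R]_4), exterior R1 x ->
    let r := radius x in
    let k := null_vec B beta s x in
    8 * pi * contract (T x) k k =
    2 * derive_within `[R1, +oo[ B r / (r * B r ^+ 3)
      * (1 + (-1) ^+ s * (B r * beta r)) ^+ 2.

Definition radial_NEC (R : realType) (R1 : R) (B beta : R -> R)
    (T : 'rV[R]_4 -> 'M[R]_4) : Prop :=
  forall (s : bool) (x : 'rV[R]_4), exterior R1 x ->
    0 <= contract (T x) (null_vec B beta s x) (null_vec B beta s x).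

(* Main.v *)
(** At each radius the squares (1 + B beta)^2 and (1 - B beta)^2 cannot both
    vanish, so one of the two null energy conditions forces B' >= 0.  Then B
    increases from B(R1) = 1 to its limit 1, hence is constant. *)
Require Import Defs.
From HB Require Import structures.
From mathcomp Require Import all_boot all_order all_algebra.
From mathcomp Require Import all_classical all_reals all_analysis.
Import Order.TTheory GRing.Theory Num.Theory numFieldNormedType.Exports.

Local Open Scope classical_set_scope.
Local Open Scope ring_scope.

(** Off [x], [f y] equals [f x] plus the difference quotient times [y - x]; the quotient converges
    and [y - x] tends to 0. The point [x] itself, which the punctured filter omits, is then added
    back. *)
Lemma diffquot_within_cvg_continuous (R : realType) (D : set R) (f : R -> R)
    (x : R) :
  cvg (diffquot f x y @[y --> within D x^']) ->
  f y @[y --> within D (nbhs x)] --> f x.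
Proof.
set l := lim _ => fx.
have id_x : y @[y --> within D x^'] --> x.
  by apply: cvg_trans; [exact: cvg_within | exact: nbhs_dnbhs].
have fx' : f y @[y --> within D x^'] --> f x.
  have : f x + diffquot f x y * (y - x) @[y --> within D x^'] -->
      f x + l * (x - x).
    apply: cvgD; first exact: cvg_cst.
    by apply: cvgM fx _; apply: cvgB id_x _; exact: cvg_cst.
  rewrite subrr mulr0 addr0; apply: cvg_trans; apply: near_eq_cvg.
  rewrite near_withinE; near=> y => _.
  have yx : y != x by near: y; exact: nbhs_dnbhs_neq.
  by rewrite /diffquot /= divfK ?subr_eq0// addrC subrK.
move=> A Ax; have Afx := nbhs_singleton Ax.
have xA : \forall y \near x, y != x -> D y -> A (f y) := fx' _ Ax.
suff : \forall y \near x, D y -> A (f y) by [].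
near=> y => Dy; have [->//|yx] := eqVneq y x.
by move: yx Dy; near: y.
Unshelve. all: by end_near. Qed.

(** When [D] is a neighbourhood of [x], restricting to [D] changes nothing near [x], so the
    substitution [y = h + x] turns the limit within [D] into the ordinary two-sided derivative. *)
Lemma diffquot_within_cvg_is_derive (R : realType) (D : set R) (f : R -> R)
    (x : R) :
  nbhs x D -> cvg (diffquot f x y @[y --> within D x^']) ->
  is_derive x 1 f (derive_within D f x).
Proof.
move=> Dx fx.
have cx : h + x @[h --> (0 : R)] --> x.
  rewrite -[X in _ --> X]add0r.
  by apply: cvgD; [exact: cvg_id | exact: cvg_cst].
have shift_x : h + x @[h --> 0^'] --> within D x^'.
  move=> A; rewrite /= /within /dnbhs /within /= => xA.
  have Dh : \forall h \near (0 : R), D (h + x) := cx _ Dx.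
  have : \forall h \near (0 : R), h + x != x -> D (h + x) -> A (h + x) :=
    cx _ xA.
  apply: filterS2 Dh => h Dh Ah h0; apply: Ah Dh.
  by rewrite -subr_eq0 addrK.
have quot : h^-1 *: ((f \o shift x) (h *: 1) - f x) @[h --> 0^'] -->
    derive_within D f x.
  apply: cvg_trans (cvg_comp _ _ shift_x fx).
  apply: near_eq_cvg; near=> h.
  by rewrite /diffquot /= addrK mulrC /GRing.scale /= mulr1.
apply: DeriveDef; first by apply/cvg_ex; eexists; exact: quot.
exact: cvg_lim quot.
Unshelve. all: by end_near. Qed.

Lemma radial_NEC_derive_ge0 (R : realType) (R1 : R) (B beta : R -> R)
    (T : 'rV[R]_4 -> 'M[R]_4) (r : R) :
  0 < R1 -> R1 <= r -> 0 < B r ->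
  radial_stress_energy R1 B beta T -> radial_NEC R1 B beta T ->
  0 <= derive_within `[R1, +oo[ B r.
Proof.
move=> R1_gt0 R1r Br T_stress T_NEC.
(* Any point of radius [r] off the axis would do; this one lies on the equator, where the colatitude
   is strictly between 0 and [pi]. *)
pose x := vec4 0 r (pi / 2) 0.
have xr : Defs.radius x = r by rewrite /Defs.radius !mxE inordK.
have ext : exterior R1 x.
  split; first by rewrite xr.
  rewrite /colatitude !mxE inordK//= divr_gt0 ?pi_gt0//=.
  by rewrite ltr_pdivrMr// ltr_pMr ?pi_gt0// ltr1n.
(* If the square is nonzero, the contraction is a positive multiple of the derivative of [B], so the
   two have the same sign. *)
have pos (s : bool) : 1 + (-1) ^+ s * (B r * beta r) != 0 ->
    0 <= derive_within `[R1, +oo[ B r.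
  move=> q0; have := T_stress s x ext; rewrite /= xr => E.
  have : 0 <= 8 * pi * Defs.contract (T x) (null_vec B beta s x)
                                        (null_vec B beta s x).
    by rewrite mulr_ge0 ?T_NEC// mulr_ge0 ?pi_ge0.
  have r_gt0 : 0 < r by exact: lt_le_trans R1r.
  rewrite E pmulr_lge0 ?exprn_even_gt0//=.
  by rewrite pmulr_lge0 ?pmulr_rge0 ?invr_gt0 ?mulr_gt0 ?exprn_gt0.
(* If the outgoing factor vanishes, then [B r * beta r = -1] and the ingoing factor equals 2. *)
have [q0|] := eqVneq (1 + (-1) ^+ false * (B r * beta r)) 0; last exact: pos.
apply: (pos true); move: q0.
rewrite expr0 expr1 mul1r mulN1r => /eqP; rewrite addrC addr_eq0 => /eqP ->.
by rewrite opprK (pnatr_eq0 _ 2).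
Qed.

Theorem theorem5 (R : realType) (R1 : R) (B beta : R -> R)
  (T : 'rV[R]_4 -> 'M[R]_4)
  (R1_gt0 : 0 < R1)
  (B_gt0 : forall r : R, R1 <= r -> 0 < B r)
  (B_C1 : C1_on `[R1, +oo[ B)
  (T_stress : radial_stress_energy R1 B beta T)
  (T_NEC : radial_NEC R1 B beta T)
  (B_inner : B R1 = 1)
  (B_infty : B r @[r --> +oo] --> (1 : R)) :
  forall r : R, R1 <= r -> B r = 1.
Proof.
have [B_diff _] := B_C1.
(* The end point [R1] is excluded: the derivative there is only one-sided. *)
have B_derive r : r \in `]R1, +oo[ ->
    is_derive r 1 B (derive_within `[R1, +oo[ B r).
  rewrite in_itv/= andbT => R1r.
  apply: diffquot_within_cvg_is_derive; last first.
    by apply: B_diff; rewrite /= in_itv/= andbT ltW.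
  near=> y; rewrite /= in_itv/= andbT.
  by near: y; exact: lt_le_nbhsr.
(* The sign of the derivative on the open half-line suffices, since continuity within the closed one
   carries monotonicity up to [R1]. *)
have B_ndecr : forall x y, R1 <= x -> x <= y -> B x <= B y.
  apply: ger0_derive1_ndecry.
  - by move=> r /B_derive [].
  - move=> r rR1; rewrite derive1E; have [_ ->] := B_derive r rR1.
    move: rR1; rewrite in_itv/= andbT => /ltW R1r.
    by apply: (@radial_NEC_derive_ge0 _ _ _ beta T) => //; exact: B_gt0.
  - apply/subspace_continuousP => x xR1.
    by apply: diffquot_within_cvg_continuous; exact: B_diff.
(* The lower bound is [B R1 <= B r]; the upper one holds because [B r <= B y] for all large [y],
   which passes to the limit 1. *)
move=> r R1r; apply/eqP; rewrite eq_le -{2}B_inner B_ndecr// andbT.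
rewrite -(cvg_lim _ B_infty)//; apply: limr_ge; first exact: cvgP B_infty.
by near=> y; apply: B_ndecr.
Unshelve. all: by end_near. Qed.
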